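(* Let $(W,S)$ be a Coxeter system and let $\mathscr I$ be a $W$-graph ideal with respect to $J\subseteq S$, with associated $\mathcal H$-module $\mathscr S$, basis $(b_w\mid w\in\mathscr I)$ and semilinear involution $\alpha\mapsto\overline\alpha$. Let $C=(c_w\mid w\in\mathscr I)$ be the unique $\mathcal A$-basis of $\mathscr S$ such that for all $w\in\mathscr I$ we have $\overline{c_w}=c_w$ and $b_w=c_w+q\sum_{y\in\mathscr I,\,y<w}q_{y,w}c_y$ for certain $q_{y,w}\in\mathcal A^+$, and let $\mu_{y,w}$ be the constant term of $q_{y,w}$. Define $\mu\colon C\times C\to\mathbb Z$ by $$\mu(c_y,c_w)=\begin{cases}\mu_{y,w}&\text{if }y<w,\\ \mu_{w,y}&\text{if }w<y,\\ 0&\text{otherwise,}\end{cases}$$ and define $\tau$ from $C$ to the power set of $S$ by $\tau(c_w)=\mathrm D_J(w)$ for all $w\in\mathscr I$. Then the triple $(C,\mu,\tau)$ is a $W$-graph.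
   Context: Let $(W,S)$ be a Coxeter system with length function $l$. The Bruhat order $\le$ on $W$ is the transitive closure of the relation $u\to w$ that holds if $l(u)\le l(w)$ and $w=tu$ with $t=1$ or $t$ a conjugate of an element of $S$; the symbols $<,\le$ always refer to it. The left weak order is: $u\le_L w$ if and only if $l(wu^{-1})=l(w)-l(u)$; then $u$ is called a suffix of $w$. $\mathcal A=\mathbb Z[q,q^{-1}]$ and $\mathcal A^+=\mathbb Z[q]$. The Hecke algebra $\mathcal H=\mathcal H(W)$ is the associative $\mathcal A$-algebra generated by $\{T_s\mid s\in S\}$ subject to $T_s^2=1+(q-q^{-1})T_s$ and $T_sT_{s'}T_s\cdots=T_{s'}T_sT_{s'}\cdots$ ($m(s,s')$ factors on each side, $m(s,s')$ the order of $ss'$). The involution $a\mapsto\overline a$ of $\mathcal A$ with $\overline q=q^{-1}$ extends to an involution of $\mathcal H$ with $\overline{T_s}=T_s^{-1}=T_s-(q-q^{-1})$. For $J\subseteq S$ let $D_J=\{w\in W\mid l(ws)>l(w)\text{ for all }s\in J\}$. Let $\mathscr I$ be an ideal of $(W,\le_L)$ (every suffix of an element of $\mathscr I$ lies in $\mathscr I$) and let $J\subseteq S$ satisfy $\mathscr I\subseteq D_J$. For $w\in\mathscr I$ put $\mathrm{SA}(w)=\{s\in S\mid sw>w,\ sw\in\mathscr I\}$, $\mathrm{SD}(w)=\{s\in S\mid sw<w\}$, $\mathrm{WA}_J(w)=\{s\in S\mid sw>w,\ sw\in D_J\setminus\mathscr I\}$, $\mathrm{WD}_J(w)=\{s\in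 S\mid sw>w,\ sw\notin D_J\}$, and $\mathrm D_J(w)=\mathrm{SD}(w)\cup\mathrm{WD}_J(w)$. $\mathscr I$ is a $W$-graph ideal with respect to $J$ if: (i) there is an $\mathcal A$-free $\mathcal H$-module $\mathscr S=\mathscr S(\mathscr I,J)$ with an $\mathcal A$-basis $(b_w\mid w\in\mathscr I)$ such that $T_sb_w=b_{sw}$ if $s\in\mathrm{SA}(w)$; $T_sb_w=b_{sw}+(q-q^{-1})b_w$ if $s\in\mathrm{SD}(w)$; $T_sb_w=-q^{-1}b_w$ if $s\in\mathrm{WD}_J(w)$; and $T_sb_w=qb_w-\sum_{y\in\mathscr I,\,y<sw}r^s_{y,w}b_y$ if $s\in\mathrm{WA}_J(w)$, for some polynomials $r^s_{y,w}\in q\mathcal A^+$; (ii) $\mathscr S$ admits an $\mathcal A$-semilinear involution $\alpha\mapsto\overline\alpha$ with $\overline{b_1}=b_1$ and $\overline{h\alpha}=\overline h\,\overline\alpha$ for all $h\in\mathcal H$, $\alpha\in\mathscr S$. (In particular $1\in\mathscr I$.) It is a fact that the basis $C$ in the claim exists and is unique. A $W$-graph is a triple $(V,\mu,\tau)$ consisting of a set $V$, a function $\mu\colon V\times V\to\mathbb Z$ and a function $\tau$ from $V$ to the power set of $S$ such that the free $\mathcal A$-module with basis $V$ admits an $\mathcal H$-module structure satisfying, for all $s\in S$ and $v\in V$, $T_sv=-q^{-1}v$ if $s\in\tau(v)$, and $T_sv=qv+\sum_{\{u\in V\mid s\in\tau(u)\}}\mu(u,v)u$ if $s\notin\tau(v)$.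 *)

(* Defs.v *)
From HB Require Import structures.
From Stdlib Require Import Relation_Operators.
From mathcomp Require Import all_boot all_order all_algebra fraction.
From mathcomp Require Import monoid all_classical.

Set Implicit Arguments.
Unset Strict Implicit.
Unset Printing Implicit Defensive.

Import GRing.Theory.

Local Open Scope classical_set_scope.
Local Open Scope ring_scope.

(** * The ring Z[q, q^-1], as a subring of the field of fractions of Z[X] *)

Local Notation Frac := {fraction {poly int}}.
Local Notation "x %:F" := (@FracField.tofrac _ x).
Local Notation fracX := ('X%:F : Frac).

Definition is_laurent : {pred Frac} :=
  fun x => `[< exists (p : {poly int}) (n : nat), x = p%:F / fracX ^+ n >].

Record laurent := Laurent { laurent_val : Frac; _ : laurent_val \in is_laurent }.

HB.instance Definition _ := [isSub for laurent_val].
HB.instance Definition _ := [Choice of laurent by <:].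

Lemma fracX_neq0 : fracX != 0.
Proof. by rewrite tofrac_eq0 polyX_eq0. Qed.

Lemma is_laurent_frac (p : {poly int}) n : p%:F / fracX ^+ n \in is_laurent.
Proof. by apply/asboolP; exists p, n. Qed.

Lemma is_laurent_subring : subring_closed is_laurent.
Proof.
split.
- by apply/asboolP; exists 1, 0%N; rewrite tofrac1 expr0 divr1.
- move=> x y /asboolP[p [n ->]] /asboolP[r [m ->]]; apply/asboolP.
  exists (p * 'X ^+ m - r * 'X ^+ n), (n + m)%N.
  rewrite tofracB !tofracM !tofracXn exprD -!mulNr.
  by rewrite addf_div ?expf_neq0 ?fracX_neq0.
- move=> x y /asboolP[p [n ->]] /asboolP[r [m ->]]; apply/asboolP.
  by exists (p * r), (n + m)%N; rewrite tofracM exprD invfM mulrACA.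
Qed.

HB.instance Definition _ :=
  GRing.isSubringClosed.Build Frac is_laurent is_laurent_subring.
HB.instance Definition _ := [SubChoice_isSubComNzRing of laurent by <:].

Lemma laurent_q_subproof : fracX \in is_laurent.
Proof. by have := is_laurent_frac 'X 0; rewrite expr0 divr1. Qed.

Lemma laurent_qV_subproof : fracX^-1 \in is_laurent.
Proof. by have := is_laurent_frac 1 1; rewrite expr1 tofrac1 mul1r. Qed.

Definition q : laurent := Laurent laurent_q_subproof.
Definition qV : laurent := Laurent laurent_qV_subproof.

Lemma mulqV : q * qV = 1.
Proof. by apply: val_inj; exact: divff fracX_neq0. Qed.

(* The embedding of Z[q], represented by {poly int}, into Z[q, q^-1]. *)
Definition polyq (p : {poly int}) : laurent := (map_poly intr p).[q].

Lemma val_polyq (p : {poly int}) : val (polyq p) = p%:F.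
Proof.
rewrite /polyq; elim/poly_ind: p => [|p c IH].
  by rewrite rmorph0 horner0 rmorph0 tofrac0.
rewrite rmorphD rmorphM /= map_polyX map_polyC /= hornerMXaddC rmorphD rmorphM /=.
congr (_ * _ + _); first exact: IH.
by rewrite -[LHS]/(val (c%:~R : laurent)) -[in RHS](intz c) !rmorph_int.
Qed.

Lemma laurentP (x : laurent) :
  exists pn : {poly int} * nat, x = polyq pn.1 * qV ^+ pn.2.
Proof.
have /asboolP[p [n e]] := valP x; exists (p, n); apply: val_inj.
by rewrite rmorphM rmorphXn /= val_polyq e exprVn.
Qed.

(* The involution q |-> q^-1: write x = p(q) / q^n and return p(q^-1) q^n;
   [laurent_barE] shows independence of the choice of p and n. *)
Definition laurent_bar (x : laurent) : laurent :=
  let pn := projT1 (cid (laurentP x)) in (map_poly intr pn.1).[qV] * q ^+ pn.2.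

Lemma laurent_barE (p : {poly int}) n :
  laurent_bar (polyq p * qV ^+ n) = (map_poly intr p).[qV] * q ^+ n.
Proof.
rewrite /laurent_bar; case: cid => -[r m] /= e.
have qVX k : qV ^+ k * q ^+ k = 1 by rewrite -exprMn mulrC mulqV expr1n.
have polyqM (a b : {poly int}) : polyq (a * b) = polyq a * polyq b.
  by rewrite /polyq rmorphM /= hornerM.
have polyqXn k : polyq ('X ^+ k) = q ^+ k.
  by rewrite /polyq rmorphXn /= map_polyX hornerXn.
have {e} : p * 'X ^+ m = r * 'X ^+ n.
  apply/eqP; rewrite -tofrac_eq -!val_polyq; apply/eqP; congr val.
  rewrite !polyqM !polyqXn.
  rewrite -[in LHS](mulr1 (polyq p)) -(qVX n) mulrA e -!mulrA.
  by rewrite [q ^+ n * _]mulrC mulrA mulrA -[polyq r * _ * _]mulrA qVX mulr1.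
move=> /(congr1 (fun a => (map_poly intr a).[qV])).
rewrite !rmorphM /= !rmorphXn /= !map_polyX !hornerM !hornerXn => e.
move: (_.[qV]) (_.[qV]) e => x y e.
by rewrite -[LHS]mulr1 -(qVX n) mulrACA -e -mulrA [qV ^+ m * _]mulrA qVX mul1r.
Qed.

Lemma laurent_bar_zmod : zmod_morphism laurent_bar.
Proof.
move=> x y; have [[p n] /= ->] := laurentP x; have [[r m] /= ->] := laurentP y.
have aux (a b d e : laurent) : d * e = 1 ->
    (a * d ^+ m - b * d ^+ n) * e ^+ (n + m) = a * e ^+ n - b * e ^+ m.
  move=> de; have deX k : d ^+ k * e ^+ k = 1 by rewrite -exprMn de expr1n.
  rewrite mulrBl exprD; congr (_ - _); last first.
    by rewrite -mulrA [d ^+ n * _]mulrA deX mul1r.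
  by rewrite [e ^+ n * _]mulrC -mulrA [d ^+ m * _]mulrA deX mul1r.
have -> : polyq p * qV ^+ n - polyq r * qV ^+ m =
    polyq (p * 'X ^+ m - r * 'X ^+ n) * qV ^+ (n + m).
  rewrite /polyq rmorphB !rmorphM /= !rmorphXn /= !map_polyX hornerD hornerN.
  by rewrite !hornerM !hornerXn aux ?mulqV.
rewrite !laurent_barE rmorphB !rmorphM /= !rmorphXn /= !map_polyX hornerD hornerN.
by rewrite !hornerM !hornerXn aux // mulrC mulqV.
Qed.

Lemma laurent_bar_monoid : monoid_morphism laurent_bar.
Proof.
split.
  have -> : 1 = polyq 1 * qV ^+ 0 by rewrite /polyq rmorph1 hornerC mulr1.
  by rewrite laurent_barE rmorph1 hornerC mulr1 /polyq rmorph1 hornerC mulr1.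
move=> x y; have [[p n] /= ->] := laurentP x; have [[r m] /= ->] := laurentP y.
have -> : polyq p * qV ^+ n * (polyq r * qV ^+ m) = polyq (p * r) * qV ^+ (n + m).
  by rewrite /polyq rmorphM /= hornerM exprD mulrACA.
by rewrite !laurent_barE rmorphM /= hornerM exprD mulrACA.
Qed.

HB.instance Definition _ :=
  GRing.isZmodMorphism.Build laurent laurent laurent_bar laurent_bar_zmod.
HB.instance Definition _ :=
  GRing.isMonoidMorphism.Build laurent laurent laurent_bar laurent_bar_monoid.

Lemma laurent_bar_q : laurent_bar q = qV.
Proof.
have -> : q = polyq 'X * qV ^+ 0 by rewrite /polyq map_polyX hornerX mulr1.
by rewrite laurent_barE map_polyX hornerX mulr1.
Qed.

(** * Coxeter systems, Bruhat order, left weak order *)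

Section Coxeter.
Variable W : groupType.
Implicit Types (S J I : set W) (s t u w x y : W).

(* m is the (finite) order of x; no m has this property if x has infinite
   order. *)
Definition has_order x (m : nat) : Prop :=
  [/\ (0 < m)%N, (x ^+ m)%g = 1%g
    & forall k, (0 < k < m)%N -> (x ^+ k)%g <> 1%g].

Definition is_word S (r : seq W) w : Prop :=
  (forall x, x \in r -> S x) /\ (\prod_(x <- r) x)%g = w.

(* S is a set of involutions generating W, and W has the universal property of
   the group presented by generators S and relations (st)^m(s,t) = 1, for
   s, t in S with m(s,t) finite. *)
Definition coxeter_system S : Prop :=
  [/\ forall s, S s -> has_order s 2,
      forall w, exists r, is_word S r w
    & forall (G : groupType) (f : W -> G),
        (forall s t m, S s -> S t -> has_order (s * t)%g m ->
           ((f s * f t) ^+ m)%g = 1%g) ->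
        exists2 phi : W -> G,
          forall x y, phi (x * y)%g = (phi x * phi y)%g
          & forall s, S s -> phi s = f s].

Definition is_length S w (n : nat) : Prop :=
  (exists2 r, is_word S r w & size r = n) /\
  (forall r, is_word S r w -> (n <= size r)%N).

Definition len S w : nat := xget 0%N (is_length S w).

Definition bruhat_step S u w : Prop :=
  (len S u <= len S w)%N /\
  exists2 t, t = 1%g \/ (exists s x, S s /\ t = (x * s * x^-1)%g)
           & w = (t * u)%g.

Definition bruhat_le S : W -> W -> Prop := clos_trans W (bruhat_step S).

Definition bruhat_lt S u w : Prop := bruhat_le S u w /\ u <> w.

(* l(w u^-1) = l(w) - l(u), written without the truncated subtraction of nat. *)
Definition weak_le S u w : Prop :=
  (len S (w * u^-1)%g + len S u)%N = len S w.

Definition weak_ideal S I : Prop := forall u w, I w -> weak_le S u w -> I u.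

Definition DJ S J : set W :=
  [set w | forall s, J s -> (len S w < len S (w * s)%g)%N].

Definition SA S I w : set W :=
  [set s | [/\ S s, bruhat_lt S w (s * w)%g & I (s * w)%g]].
Definition SD S w : set W :=
  [set s | S s /\ bruhat_lt S (s * w)%g w].
Definition WA S J I w : set W :=
  [set s | [/\ S s, bruhat_lt S w (s * w)%g & (DJ S J `\` I) (s * w)%g]].
Definition WD S J w : set W :=
  [set s | [/\ S s, bruhat_lt S w (s * w)%g & ~ DJ S J (s * w)%g]].
Definition descents S J w : set W := SD S w `|` WD S J w.

End Coxeter.

(** * The Hecke algebra *)

(* The alternating product x y x y ... with m factors. *)
Definition altprod (B : nzRingType) (m : nat) (x y : B) : B :=
  \prod_(i < m) (if odd i then y else x).

Section Hecke.
Variables (W : groupType) (S : set W).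

Definition hecke_relations (B : algType laurent) (T : W -> B) : Prop :=
  (forall s, S s -> T s ^+ 2 = 1 + (q - qV) *: T s) /\
  (forall s t m, S s -> S t -> has_order (s * t)%g m ->
     altprod m (T s) (T t) = altprod m (T t) (T s)).

(* H is the algebra presented by generators T_s (s in S) and the relations
   above; only the values of T on S are meaningful. *)
Definition hecke_algebra (H : algType laurent) (T : W -> H) : Prop :=
  hecke_relations T /\
  forall (B : algType laurent) (T' : W -> B), hecke_relations T' ->
    exists2 phi : {lrmorphism H -> B},
      forall s, S s -> phi (T s) = T' s
      & forall psi : {lrmorphism H -> B},
          (forall s, S s -> psi (T s) = T' s) -> psi =1 phi.

Record hecke_bar (H : algType laurent) (T : W -> H) (bar : H -> H) : Prop := {
  hbarD : forall g h, bar (g + h) = bar g + bar h;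
  hbarM : forall g h, bar (g * h) = bar g * bar h;
  hbar1 : bar 1 = 1;
  hbarZ : forall (a : laurent) h, bar (a *: h) = laurent_bar a *: bar h;
  hbarK : involutive bar;
  hbarT : forall s, S s -> bar (T s) = T s - (q - qV)%:A }.

(* An H-module is an A-module through the structure map A -> H. *)
Definition ascale (H : algType laurent) (M : lmodType H) (a : laurent) (m : M)
  : M := (a%:A : H) *: m.

End Hecke.

Notation "a *A: m" := (ascale a m) (at level 40, m at next level).

(* (e k | k in D) is an A-basis of the H-module M.  A sum \sum_(k \in D) F k is
   0 by convention if F has infinite support on D, whence the explicit
   finiteness conditions. *)
Definition A_basis (H : algType laurent) (M : lmodType H) (K : choiceType)
    (D : set K) (e : K -> M) : Prop :=
  (forall m : M, exists2 a : K -> laurent,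
     finite_set (D `&` [set k | a k != 0]) & m = \sum_(k \in D) a k *A: e k) /\
  (forall a : K -> laurent, finite_set (D `&` [set k | a k != 0]) ->
     \sum_(k \in D) a k *A: e k = 0 -> forall k, D k -> a k = 0).

(** * W-graphs and W-graph ideals *)

Section WGraph.
Variables (W : groupType) (S : set W) (H : algType laurent) (T : W -> H).

(* "The free A-module with basis V admits an H-module structure" is expressed as
   the existence of an H-module with an A-basis (e v | v : V).  The finiteness
   condition is implicit in the sum in T_s v being an element of that module. *)
Definition W_graph (V : choiceType) (mu : V -> V -> int) (tau : V -> set W)
  : Prop :=
  (forall v, tau v `<=` S) /\
  exists (N : lmodType H) (e : V -> N),
    A_basis setT e /\
    forall s v, S s ->
      (tau v s -> T s *: e v = (- qV) *A: e v) /\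
      (~ tau v s ->
         finite_set [set u | tau u s /\ mu u v != 0] /\
         T s *: e v =
           q *A: e v + \sum_(u \in [set u | tau u s]) e u *~ mu u v).

Variable barH : H -> H.

(* I is a W-graph ideal with respect to J, with module M, basis
   (b w | w in I) and involution barM; values of b outside I are
   meaningless. *)
Record W_graph_ideal (J I : set W) (M : lmodType H) (b : W -> M)
    (barM : M -> M) : Prop := {
  wgi_J : J `<=` S;
  wgi_ideal : weak_ideal S I;
  wgi_DJ : I `<=` DJ S J;
  wgi_1 : I 1%g;
  wgi_basis : A_basis I b;
  wgi_SA : forall w s, I w -> SA S I w s -> T s *: b w = b (s * w)%g;
  wgi_SD : forall w s, I w -> SD S w s ->
    T s *: b w = b (s * w)%g + (q - qV) *A: b w;
  wgi_WD : forall w s, I w -> WD S J w s -> T s *: b w = (- qV) *A: b w;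
  wgi_WA : forall w s, I w -> WA S J I w s ->
    exists r : W -> {poly int},
      T s *: b w =
        q *A: b w -
        \sum_(y \in [set y | I y /\ bruhat_lt S y (s * w)%g])
          polyq ('X * r y) *A: b y;
  wgi_barD : forall m n, barM (m + n) = barM m + barM n;
  wgi_barZ : forall (a : laurent) m, barM (a *A: m) = laurent_bar a *A: barM m;
  wgi_barK : involutive barM;
  wgi_bar1 : barM (b 1%g) = b 1%g;
  wgi_barH : forall h m, barM (h *: m) = barH h *: barM m }.

(* (c w | w in I) is a bar-invariant A-basis with
   b_w = c_w + q \sum_(y in I, y < w) q_{y,w} c_y, where q_{y,w} is [qp y w]. *)
Record canonical_basis (I : set W) (M : lmodType H) (b : W -> M)
    (barM : M -> M) (c : W -> M) (qp : W -> W -> {poly int}) : Prop := {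
  cb_basis : A_basis I c;
  cb_bar : forall w, I w -> barM (c w) = c w;
  cb_qp : forall w, I w ->
    b w = c w + q *A: \sum_(y \in [set y | I y /\ bruhat_lt S y w])
                        polyq (qp y w) *A: c y }.

End WGraph.

(* c_w as an element of the set C = {c_w | w in I}. *)
Definition in_img (T U : Type) (f : T -> U) (I : set T) (w : T) (Iw : I w)
  : f @` I := SigSub (mem_set (imageP f Iw)).

(* Main.v *)
From HB Require Import structures.
From Stdlib Require Import Relation_Operators.
Require Import Defs.
From mathcomp Require Import all_boot all_order all_algebra fraction ring.
From mathcomp Require Import monoid all_classical.

Set Implicit Arguments.
Unset Strict Implicit.
Unset Printing Implicit Defensive.

Import GRing.Theory.

Local Open Scope classical_set_scope.
Local Open Scope ring_scope.

(** The module of the W-graph is M itself with the basis C, so the W-graph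
    relations have to be verified in M.  They are stated for the generators
    C_s = T_s - q, which commute with the bar involutions and satisfy
    C_s C_s = - (q + q^-1) C_s.  The relations to prove are then
      C_s c_w = - (q + q^-1) c_w                           if s is in D_J(w),
      C_s c_w = sum of mu(c_u, c_w) c_u over s in D_J(u)   otherwise.

    The engine is that a bar-invariant element of Z[q] is an integer, namely
    its constant term ([polyq_bar_const], [const_term_bar]).  As C_s c_w is
    bar-invariant, so are its coordinates in the basis C; hence such a
    coordinate is known as soon as it is known to lie in Z[q] and its constant
    term is known.

    The proof is by induction on the length of w.  Applying C_s to
    b_w = c_w + q sum q_{y,w} c_y, and using the induction hypothesis for the
    terms C_s c_y with y < w, expresses C_s c_w through C_s b_w, which the axioms
    of a W-graph ideal provide.  Three cases arise.
    - s is not a descent of w ([canonical_action_nondesc]).  All the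
      coordinates lie in Z[q]; their constant terms give
      C_s c_w = [c_{sw} if sw is in I] + sum of mu_{y,w} c_y over the y < w
      having s as a descent.
    - s is a weak descent of w ([canonical_action_WD]).  The same computation
      shows that (C_s + q + q^-1) c_w has a coordinate - (1 + q^2) q_{y,w} at
      each y < w for which s is not a descent, and no other nonzero coordinate.
      It is bar-invariant, hence an integer, which forces q_{y,w} = 0.
    - s is a strong descent of w ([canonical_action_SD]).  With v = sw, the first
      case expresses c_w through C_s c_v and the c_y with y < v, s in D_J(y); all
      these are eigenvectors of C_s for - (q + q^-1), so c_w is one as well.
    The first case leaves out the terms of the W-graph relation indexed by the
    u > w with s in D_J(u).  To recover them the induction also determines
    mu_{y,w} when s is a descent of w and not of y < w: it is 1 if y = sw and 0
    otherwise.  So only u = sw contributes, and that is the term c_{sw} above.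

    What is needed about Coxeter groups is that Bruhat lower intervals are
    finite, that u < w implies l(u) < l(w), and that w and sw are comparable.
    All three follow from the reflection cocycle N : for a reflection t,
    l(tw) < l(w) exactly when N w t holds, and N w has finite support. *)

(** * The reflection cocycle *)

Section ReflectionGroup.
Local Open Scope group_scope.
Variable W : groupType.

(** The semidirect product of the Z/2-valued functions on W by W acting through
    conjugation.  A homomorphism from W to this group that lifts the identity is
    the same thing as a cocycle W -> (W -> Z/2). *)
Definition refl_group : Type := ((W -> bool) * W)%type.

HB.instance Definition _ := Choice.on refl_group.

Definition refl_one : refl_group := (fun=> false, 1).
Definition refl_mul (a b : refl_group) : refl_group :=
  (fun y => a.1 y (+) b.1 (a.2^-1 * y * a.2), a.2 * b.2).
Definition refl_inv (a : refl_group) : refl_group :=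
  (fun y => a.1 (a.2 * y * a.2^-1), a.2^-1).

Lemma refl_mulA : associative refl_mul.
Proof.
move=> a b c; congr pair; last exact: mulgA.
by apply/funext => y /=; rewrite addbA invgM !mulgA.
Qed.

Lemma refl_mul1 : left_id refl_one refl_mul.
Proof.
move=> [a x]; congr pair; last exact: mul1g.
by apply/funext => y /=; rewrite invg1 mul1g mulg1.
Qed.

Lemma refl_mulr1 : right_id refl_one refl_mul.
Proof.
move=> [a x]; congr pair; last exact: mulg1.
by apply/funext => y /=; rewrite addbF.
Qed.

Lemma refl_mulV : left_inverse refl_one refl_inv refl_mul.
Proof.
move=> [a x]; congr pair; last exact: mulVg.
by apply/funext => y /=; rewrite invgK addbb.
Qed.

Lemma refl_mulrV : right_inverse refl_one refl_inv refl_mul.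
Proof.
move=> [a x]; congr pair; last exact: mulgV.
by apply/funext => y /=; rewrite !mulgA mulgV mul1g mulgK addbb.
Qed.

HB.instance Definition _ := isGroup.Build refl_group
  refl_mulA refl_mul1 refl_mulr1 refl_mulV refl_mulrV.

Definition refl_gen (s : W) : refl_group := ((fun y => y == s), s).

(** The function part counts mod 2 the factors of the word s t s t ... of length
    2n at which a given y is the associated reflection (st)^i s.  The recursion
    conjugates by st, which sends (st)^i s to (st)^(i+2) s. *)
Lemma refl_gen_exp (s t : W) (n : nat) : s * s = 1 -> t * t = 1 ->
  (refl_gen s * refl_gen t) ^+ n =
  ((fun y => \big[addb/false]_(0 <= i < n.*2) (y == (s * t) ^+ i * s)),
   (s * t) ^+ n).
Proof.
move=> ss tt; have sV : s^-1 = s by rewrite -[LHS]mulg1 -ss mulKg.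
have tV : t^-1 = t by rewrite -[LHS]mulg1 -tt mulKg.
elim: n => [|n IHn].
  rewrite !expg0; congr pair; apply/funext => y.
  by rewrite big_nil.
rewrite expgS IHn -[LHS]/(refl_mul (refl_mul _ _) _) /refl_mul /=.
congr pair; last by rewrite expgS.
apply/funext => y; rewrite doubleS big_nat_recl // big_nat_recl //= addbA.
congr (_ (+) _ (+) _); first by rewrite expg0 mul1g.
  rewrite expg1 sV; apply/eqP/eqP => [<-|->]; rewrite !mulgA ss mul1g -?mulgA.
    by rewrite ss mulg1.
  by rewrite ss mulg1.
apply: eq_bigr => i _.
have conjE (g z : W) : (g^-1 * y * g == z) = (y == g * z * g^-1).
  by apply/eqP/eqP => [<-|->]; rewrite !mulgA (mulgV, mulVg) mul1g (mulgK, mulgVK).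
rewrite conjE invgM sV tV; congr (y == _).
by rewrite (mulgA (s * t)) -expgS [in RHS]expgSr !mulgA.
Qed.

(** The i-th and the (m+i)-th reflections coincide when (st)^m = 1, so the
    counts cancel mod 2; this makes the universal property of W applicable. *)
Lemma refl_gen_rel (s t : W) (m : nat) : s * s = 1 -> t * t = 1 ->
  has_order (s * t) m -> (refl_gen s * refl_gen t) ^+ m = 1.
Proof.
move=> ss tt [_ stm _]; rewrite refl_gen_exp // stm; congr pair.
apply/funext => y; rewrite -addnn big_mkord big_split_ord /=.
under [X in _ (+) X]eq_bigr => i _ do rewrite expgnDr stm mul1g.
by rewrite addbb.
Qed.

End ReflectionGroup.

Section CoxeterFacts.
Local Open Scope group_scope.
Variables (W : groupType) (S : set W).
Hypothesis hS : coxeter_system S.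
Implicit Types s t u w x y : W.

Lemma gen_invol s : S s -> s * s = 1.
Proof. by move=> Ss; have [/(_ s Ss)[]] := hS. Qed.

Lemma gen_neq1 s : S s -> s <> 1.
Proof.
move=> Ss; have [/(_ s Ss)[_ _ /(_ 1%N isT) ne1 _ _]] := hS.
by rewrite expg1 in ne1.
Qed.

Lemma gen_inv s : S s -> s^-1 = s.
Proof. by move=> Ss; rewrite -[LHS]mulg1 -(gen_invol Ss) mulKg. Qed.

(** The universal property extends s |-> (delta_s, s) to a homomorphism, whose
    function part is the cocycle; the group part is the identity because it is
    so on generators. *)
Lemma refl_cocycle_exists : exists N : W -> W -> bool,
  (forall s y, S s -> N s y = (y == s)) /\
  (forall u v y, N (u * v) y = N u y (+) N v (u^-1 * y * u)).
Proof.
have [_ gen /(_ (refl_group W) (@refl_gen W))[]] := hS.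
  by move=> s t m Ss St; apply: refl_gen_rel; exact: gen_invol.
move=> phi phiM phiS; exists (fun w => (phi w).1); split.
  by move=> s y /phiS ->.
suff phi2 w : (phi w).2 = w.
  by move=> u v y; rewrite phiM -[_ * _]/(refl_mul _ _) /= phi2.
have phi1 : phi 1 = 1.
  by apply: (mulgI (phi 1)); rewrite -phiM !mulg1.
have [r [Sr <-]] := gen w.
elim: r Sr => [|x r IHr] Sr; first by rewrite big_nil phi1.
rewrite big_cons phiM -[_ * _]/(refl_mul _ _) /= IHr.
  by rewrite phiS //; apply: Sr; rewrite mem_head.
by move=> y yr; apply: Sr; rewrite inE yr orbT.
Qed.

Definition refl_cocycle := projT1 (cid refl_cocycle_exists).
Local Notation N := refl_cocycle.

Lemma cocycle_gen s y : S s -> N s y = (y == s).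
Proof. by rewrite /N; case: cid => /= ? [h _]; exact: h. Qed.

Lemma cocycleM u v y : N (u * v) y = N u y (+) N v (u^-1 * y * u).
Proof. by rewrite /N; case: cid => /= ? [_ h]; exact: h. Qed.

Lemma cocycle1 y : N 1 y = false.
Proof.
have := cocycleM 1 1 y; rewrite invg1 !mul1g mulg1.
by case: (N 1 y).
Qed.

Definition is_refl t := exists s x, S s /\ t = x * s * x^-1.

Lemma gen_refl s : S s -> is_refl s.
Proof. by move=> Ss; exists s, 1; rewrite invg1 mulg1 mul1g. Qed.

Lemma reflK t : is_refl t -> t * t = 1.
Proof.
move=> [s [x [Ss ->]]]; rewrite !mulgA mulgVK -(mulgA x) gen_invol //.
by rewrite mulg1 mulgV.
Qed.

Lemma reflV t : is_refl t -> t^-1 = t.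
Proof. by move=> rt; rewrite -[LHS]mulg1 -(reflK rt) mulKg. Qed.

(** For t = x s x^-1 the contributions of x and x^-1 cancel, because N 1 = 0;
    the one of s remains. *)
Lemma cocycle_refl t : is_refl t -> N t t.
Proof.
move=> [s [x [Ss et]]].
have xt : x^-1 * t * x = s by rewrite et !mulgA mulVg mul1g mulgVK.
have Nx : N x t (+) N x^-1 s = false by rewrite -xt -cocycleM mulgV cocycle1.
rewrite {1}et -mulgA cocycleM xt cocycleM (cocycle_gen _ Ss) eqxx.
by rewrite mulVg mul1g addbCA Nx.
Qed.

Lemma cocycle_reflM t w : is_refl t -> N (t * w) t = ~~ N w t.
Proof.
move=> rt; rewrite cocycleM cocycle_refl //.
by rewrite -mulgA (reflK rt) mulg1 reflV.
Qed.

(** * Lengths and the Bruhat order *)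

Lemma len_spec w : is_length S w (len S w).
Proof.
rewrite /len; apply: (@xgetPex _ 0%N).
have [_ gen _] := hS; have [r0 wr0] := gen w.
have ex : exists n, `[< exists2 r, is_word S r w & size r = n >].
  by exists (size r0); apply/asboolP; exists r0.
case: (ex_minnP ex) => n /asboolP nP nmin; exists n; split=> // r wr.
by apply: nmin; apply/asboolP; exists r.
Qed.

Lemma len_le_word r : (forall x, x \in r -> S x) ->
  (len S (\prod_(x <- r) x)%g <= size r)%N.
Proof. by move=> Sr; have [_] := len_spec (\prod_(x <- r) x)%g; apply. Qed.

(** The strong exchange condition: N w t holds only if t is the reflection
    attached to some letter of the word, and deleting that letter multiplies the
    product by t. *)
Lemma exchange r t : (forall x, x \in r -> S x) ->
  N (\prod_(x <- r) x) t ->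
  exists r', [/\ forall x, x \in r' -> S x, (size r' < size r)%N
    & \prod_(x <- r') x = t * \prod_(x <- r) x].
Proof.
elim: r t => [|x r IHr] t Sr; first by rewrite big_nil cocycle1.
have Sx : S x by apply: Sr; rewrite mem_head.
have {}Sr y : y \in r -> S y by move=> yr; apply: Sr; rewrite inE yr orbT.
rewrite big_cons cocycleM cocycle_gen //.
have [->|_] /= := eqVneq t x.
  by move=> _; exists r; rewrite mulgA gen_invol // mul1g.
move=> /(IHr _ Sr)[r' [Sr' ltr e]]; exists (x :: r'); split=> //.
  by move=> y; rewrite inE => /orP[/eqP ->|/Sr'].
by rewrite big_cons e !mulgA mulgV mul1g.
Qed.

Lemma cocycle_len t w : N w t -> (len S (t * w) < len S w)%N.
Proof.
have [[r [Sr <-] <-] _] := len_spec w.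
move=> /(exchange Sr)[r' [Sr' ltr <-]].
exact: leq_ltn_trans (len_le_word Sr') ltr.
Qed.

(** N (t w) t is the negation of N w t, so [cocycle_len] applies to t w. *)
Lemma cocycle_lenN t w : is_refl t -> ~~ N w t -> (len S w < len S (t * w))%N.
Proof.
move=> rt; rewrite -cocycle_reflM // => /cocycle_len.
by rewrite mulgA reflK // mul1g.
Qed.

Lemma cocycle_fin w : finite_set [set t | N w t].
Proof.
have [_ gen _] := hS; have [r [Sr <-]] := gen w.
elim: r Sr => [|x r IHr] Sr.
  suff -> : [set t | N (\prod_(x <- [::]) x) t] = set0 by exact: finite_set0.
  by apply/seteqP; split=> t //=; rewrite big_nil cocycle1.
have {}IHr : finite_set [set t | N (\prod_(x <- r) x) t].
  by apply: IHr => y yr; apply: Sr; rewrite inE yr orbT.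
apply: (@sub_finite_set _ _ ([set x] `|`
    (fun t => x * t * x^-1) @` [set t | N (\prod_(x <- r) x) t])); last first.
  by rewrite finite_setU; split; [exact: finite_set1|exact: finite_image].
move=> t /=; rewrite big_cons cocycleM (cocycle_gen _ (Sr _ (mem_head _ _))).
have [->|_] /= := eqVneq t x; first by left.
by move=> Nt; right; exists (x^-1 * t * x); rewrite // !mulgA mulgV mul1g mulgK.
Qed.

Lemma bruhat_step_cocycle u w : bruhat_step S u w ->
  u = w \/ exists2 t, N w t & u = t * w.
Proof.
move=> [lenuw [t [->|rt] ew]]; first by left; rewrite ew mul1g.
have {}rt : is_refl t by [].
right; exists t; last by rewrite ew mulgA reflK // mul1g.
rewrite ew cocycle_reflM //; apply/negP => /cocycle_len.
by rewrite -ew ltnNge lenuw.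
Qed.

Lemma bruhat_le_len u w : bruhat_le S u w -> u = w \/ (len S u < len S w)%N.
Proof.
elim=> {u w} [u w|u v w _ IH1 _ IH2].
  move=> /bruhat_step_cocycle[|[t Nt ->]]; first by left.
  by right; exact: cocycle_len.
case: IH1 => [->|lt1] //; case: IH2 => [<-|lt2]; right=> //.
exact: ltn_trans lt2.
Qed.

Lemma bruhat_lt_len u w : bruhat_lt S u w -> (len S u < len S w)%N.
Proof. by move=> [/bruhat_le_len[|//]] + neq. Qed.

Lemma bruhat_lt_trans u v w : bruhat_lt S u v -> bruhat_lt S v w ->
  bruhat_lt S u w.
Proof.
move=> uv vw; split; first exact: t_trans uv.1 vw.1.
move=> e; have := ltn_trans (bruhat_lt_len uv) (bruhat_lt_len vw).
by rewrite e ltnn.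
Qed.

Lemma bruhat_le_refl w : bruhat_le S w w.
Proof. by apply: t_step; split=> //; exists 1; [left|rewrite mul1g]. Qed.

(** Splits off the top step of a Bruhat chain; there are finitely many choices
    for it, and it decreases the length, whence [bruhat_le_fin]. *)
Lemma bruhat_le_last u w : bruhat_le S u w ->
  u = w \/ exists2 t, N w t & bruhat_le S u (t * w).
Proof.
elim=> {u w} [u w|u v w uv IHuv _ [<- //|[t Nt vt]]].
  move=> /bruhat_step_cocycle[|[t Nt ->]]; first by left.
  by right; exists t => //; exact: bruhat_le_refl.
by right; exists t => //; exact: t_trans vt.
Qed.

Lemma bruhat_le_fin w : finite_set [set u | bruhat_le S u w].
Proof.
elim: {w}(len S w) {-2}w (leqnn (len S w)) => [|n IHn] w lenw.
  apply: sub_finite_set (finite_set1 w) => u /bruhat_le_len[//|].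
  by move: lenw; rewrite leqn0 => /eqP ->.
apply: (@sub_finite_set _ _ ([set w] `|` \bigcup_(t in [set t | N w t])
    [set u | bruhat_le S u (t * w)])).
  by move=> u /bruhat_le_last[->|[t Nt ut]]; [left|right; exists t].
rewrite finite_setU; split; first exact: finite_set1.
apply: bigcup_finite (cocycle_fin w) _ => t /cocycle_len lt.
by apply: IHn; rewrite -ltnS; exact: leq_trans lt lenw.
Qed.

Lemma gen_bruhat s w : S s -> (len S (s * w) < len S w)%N ->
  bruhat_lt S (s * w) w.
Proof.
move=> Ss lt; split; last by move=> e; rewrite e ltnn in lt.
apply: t_step; split; first exact: ltnW.
exists s; last by rewrite mulgA gen_invol // mul1g.
by right; have [s' [x ?]] := gen_refl Ss; exists s', x.
Qed.

Lemma gen_mulK s w : S s -> s * (s * w) = w.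
Proof. by move=> Ss; rewrite mulgA gen_invol // mul1g. Qed.

Lemma gen_bruhat_total s w : S s ->
  bruhat_lt S (s * w) w \/ bruhat_lt S w (s * w).
Proof.
move=> Ss; case Nw : (N w s).
  by left; apply: gen_bruhat => //; exact: cocycle_len.
right; rewrite -{1}(gen_mulK w Ss); apply: gen_bruhat => //.
by rewrite gen_mulK //; apply: cocycle_lenN; [exact: gen_refl|rewrite Nw].
Qed.

Lemma len_gen s : S s -> len S s = 1%N.
Proof.
move=> Ss; apply/eqP; rewrite eqn_leq; apply/andP; split.
  have := @len_le_word [:: s]; rewrite big_seq1; apply=> x.
  by rewrite inE => /eqP ->.
have [[r [_ es] <-] _] := len_spec s.
by case: r es => //; rewrite big_nil => /esym /(gen_neq1 Ss).
Qed.

Lemma len_gen_mul s w : S s -> (len S (s * w) <= (len S w).+1)%N.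
Proof.
move=> Ss; have [[r [Sr <-] <-] _] := len_spec w.
have := @len_le_word (s :: r); rewrite big_cons; apply=> x.
by rewrite inE => /orP[/eqP ->|/Sr].
Qed.

Lemma SD_weak_le s w : SD S w s -> weak_le S (s * w) w.
Proof.
move=> [Ss /bruhat_lt_len lt]; rewrite /weak_le invgM (gen_inv Ss) mulgA mulgV mul1g.
rewrite (len_gen Ss) add1n; apply/eqP; rewrite eqn_leq lt /=.
by rewrite -{1}(gen_mulK w Ss) len_gen_mul.
Qed.

End CoxeterFacts.

(** * Bar-invariant Laurent polynomials *)

Lemma polyq_zmod : zmod_morphism polyq.
Proof. by move=> p r; rewrite /polyq rmorphB hornerD hornerN. Qed.

Lemma polyq_monoid : monoid_morphism polyq.
Proof.
split; first by rewrite /polyq rmorph1 hornerC.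
by move=> p r; rewrite /polyq rmorphM hornerM.
Qed.

HB.instance Definition _ :=
  GRing.isZmodMorphism.Build {poly int} laurent polyq polyq_zmod.
HB.instance Definition _ :=
  GRing.isMonoidMorphism.Build {poly int} laurent polyq polyq_monoid.

Lemma polyqX : polyq 'X = q.
Proof. by rewrite /polyq map_polyX hornerX. Qed.

Lemma polyqC n : polyq n%:P = n%:~R.
Proof. by rewrite /polyq map_polyC hornerC. Qed.

Lemma polyq_inj : injective polyq.
Proof.
by move=> p r /(congr1 val); rewrite !val_polyq => /eqP; rewrite tofrac_eq => /eqP.
Qed.

Lemma polyq_horner (p : {poly int}) (x : laurent) :
  (map_poly intr p).[x] = \sum_(i < size p) (p`_i)%:~R * x ^+ i.
Proof.
rewrite (horner_coef_wide _ (size_poly _ _)).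
by apply: eq_bigr => i _; rewrite coef_map.
Qed.

(** The right-hand side is the reciprocal polynomial of p. *)
Lemma laurent_bar_polyq p :
  laurent_bar (polyq p) * q ^+ (size p).-1 =
  polyq (\sum_(i < size p) (p`_i)%:P * 'X^((size p).-1 - i)).
Proof.
have -> : polyq p = polyq p * qV ^+ 0 by rewrite mulr1.
rewrite laurent_barE mulr1 polyq_horner mulr_suml rmorph_sum /=.
apply: eq_bigr => i _; rewrite rmorphM rmorphXn /= polyqC polyqX -mulrA.
congr (_ * _).
have le_i : (i <= (size p).-1)%N by rewrite -ltnS (ltn_predK (ltn_ord i)).
rewrite -{1}(subnKC le_i) exprD mulrA -exprMn mulrC.
by rewrite [qV * q]mulrC mulqV expr1n mulr1.
Qed.

(** With n the degree of p, bar-invariance says that q^n p(q) is the reciprocal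
    polynomial of p; the latter has degree at most n, so n = 0. *)
Lemma polyq_bar_const p :
  laurent_bar (polyq p) = polyq p -> p = (p`_0)%:P.
Proof.
move=> barp; apply: size1_polyC.
have [->|p0] := eqVneq p 0; first by rewrite size_poly0.
have := laurent_bar_polyq p; rewrite barp -polyqX -rmorphXn -rmorphM.
move=> /polyq_inj/(congr1 (fun r : {poly int} => size r)).
rewrite size_mulXn //; set n := size p => e.
have : (size (\sum_(i < n) (p`_i)%:P * 'X^(n.-1 - i))%R <= n.-1.+1)%N.
  apply: (leq_trans (size_sum _ _ _)); apply/bigmax_leqP => i _.
  rewrite mul_polyC; apply: leq_trans (size_scale_leq _ _) _.
  by rewrite size_polyXn ltnS leq_subr.
rewrite -e; have : (0 < n)%N by rewrite size_poly_gt0.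
by case: n {e} => // n _ /=; rewrite -{2}[n.+1]add0n leq_add2r leqn0 => /eqP ->.
Qed.

(** A relation, so that it also says that a lies in Z[q]. *)
Definition const_term (a : laurent) (z : int) : Prop :=
  exists2 p, a = polyq p & p`_0 = z.

Lemma const_term_int (z : int) : const_term z%:~R z.
Proof. by exists z%:P; rewrite ?polyqC ?coefC. Qed.

Lemma const_term_polyq p : const_term (polyq p) p`_0.
Proof. by exists p. Qed.

Lemma const_term_q : const_term q 0.
Proof. by exists 'X; rewrite ?polyqX ?coefX. Qed.

Lemma const_termD a b y z :
  const_term a y -> const_term b z -> const_term (a + b) (y + z).
Proof.
by move=> [p -> <-] [r -> <-]; exists (p + r); rewrite ?rmorphD ?coefD.
Qed.

Lemma const_termN a z : const_term a z -> const_term (- a) (- z).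
Proof. by move=> [p -> <-]; exists (- p); rewrite ?rmorphN ?coefN. Qed.

Lemma const_termM a b y z :
  const_term a y -> const_term b z -> const_term (a * b) (y * z).
Proof.
move=> [p -> <-] [r -> <-]; exists (p * r); rewrite ?rmorphM //.
by rewrite coefM big_ord1.
Qed.

Lemma const_term_qM a z : const_term a z -> const_term (q * a) 0.
Proof. by move=> /(const_termM const_term_q); rewrite mul0r. Qed.

Lemma const_term_sum (K : eqType) (r : seq K)
    (a : K -> laurent) (z : K -> int) :
  {in r, forall k, const_term (a k) (z k)} ->
  const_term (\sum_(k <- r) a k) (\sum_(k <- r) z k).
Proof.
elim: r => [|k r IHr] az; first by rewrite !big_nil; exact: (const_term_int 0).
rewrite !big_cons; apply: const_termD; first by apply: az; rewrite mem_head.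
by apply: IHr => l lr; apply: az; rewrite inE lr orbT.
Qed.

Lemma const_term_bar a z : const_term a z -> laurent_bar a = a -> a = z%:~R.
Proof. by move=> [p -> <-] /polyq_bar_const {1}->; rewrite polyqC. Qed.

Lemma sum_pick (V : nmodType) (K : eqType) (r : seq K) (k : K) (F : K -> V) :
  uniq r ->
  \sum_(y <- r) (if k == y then F y else 0) = if k \in r then F k else 0.
Proof.
move=> ur; have [kr|kr] := boolP (k \in r).
  rewrite (bigD1_seq k) //= eqxx big1 ?addr0 // => y.
  by rewrite eq_sym => /negbTE ->.
by rewrite big_seq big1 // => y yr; case: eqP => // ky; rewrite ky yr in kr.
Qed.

(** * Coordinates in a basis over the Laurent polynomials *)

Section AScale.
Variables (H : algType laurent) (M : lmodType H).
Implicit Types (a : laurent) (m : M) (h : H).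

Lemma ascale_zmod a : zmod_morphism (@ascale H M a).
Proof. by move=> m n; rewrite /ascale scalerBr. Qed.

HB.instance Definition _ a :=
  GRing.isZmodMorphism.Build M M (@ascale H M a) (ascale_zmod a).

Lemma ascaleDl a a' m : (a + a') *A: m = a *A: m + a' *A: m.
Proof. by rewrite /ascale !scalerDl. Qed.

Lemma ascaleNl a m : (- a) *A: m = - (a *A: m).
Proof. by rewrite /ascale !scaleNr. Qed.

Lemma ascale0l m : 0 *A: m = 0.
Proof. by rewrite /ascale !scale0r. Qed.

Lemma ascale1 m : 1 *A: m = m.
Proof. by rewrite /ascale !scale1r. Qed.

Lemma ascaleA a a' m : a *A: (a' *A: m) = (a * a') *A: m.
Proof. by rewrite /ascale !scalerA -scalerAl mul1r scalerA. Qed.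

Lemma ascale_int m (n : int) : n%:~R *A: m = m *~ n.
Proof. by rewrite /ascale !scaler_int. Qed.

Lemma hscale_ascale h a m : h *: (a *A: m) = a *A: (h *: m).
Proof. by rewrite /ascale !scalerA -scalerAl mul1r -scalerAr mulr1. Qed.

End AScale.

Section Coordinates.
Variables (H : algType laurent) (M : lmodType H) (K : choiceType).
Variables (D : set K) (e : K -> M).
Hypothesis basis : A_basis D e.
Implicit Types (m n : M) (k : K) (a : K -> laurent) (r : seq K).

(** Moves between sums over a possibly infinite set and sums over a sequence
    that contains the support. *)
Lemma fsum_seq (F : K -> M) r : uniq r ->
  (forall k, ~ D k -> F k = 0) -> (forall k, k \notin r -> F k = 0) ->
  \sum_(k \in D) F k = \sum_(k <- r) F k.
Proof.
move=> ur FD Fr; rewrite [RHS]fsbig_seq // (fsbig_widen D setT) //; last first.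
  by move=> k [_ /FD].
by apply/esym/fsbig_widen => // k [_ /= /negP /Fr].
Qed.

Lemma bcoord_exists m : exists a, [/\ forall k, ~ D k -> a k = 0,
  finite_set [set k | a k != 0] & m = \sum_(k \in D) a k *A: e k].
Proof.
have [a fin em] := basis.1 m.
exists (fun k => if `[< D k >] then a k else 0); split.
- by move=> k /asboolPn /negbTE ->.
- apply: (sub_finite_set _ fin) => k /=.
  by case: asboolP => [Dk ak|_]; [split|rewrite eqxx].
- rewrite em; apply: eq_fsbigr => k; rewrite inE => Dk.
  by case: asboolP.
Qed.

(** The coordinates of m, extended by 0 outside D. *)
Definition bcoord m : K -> laurent := projT1 (cid (bcoord_exists m)).

Lemma bcoord_out m k : ~ D k -> bcoord m k = 0.
Proof. by rewrite /bcoord; case: cid => a [/= h _ _]; exact: h. Qed.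

Lemma bcoord_fin m : finite_set [set k | bcoord m k != 0].
Proof. by rewrite /bcoord; case: cid => a []. Qed.

Lemma bcoord_fsum m : m = \sum_(k \in D) bcoord m k *A: e k.
Proof. by rewrite /bcoord; case: cid => a []. Qed.

Lemma bcoord_supp m : exists2 r, uniq r & forall k, k \notin r -> bcoord m k = 0.
Proof.
have [r er] := (finite_seqP _).1 (bcoord_fin m).
exists (undup r); first exact: undup_uniq.
move=> k; rewrite mem_undup; apply: contraNeq => ak.
by have : [set k | bcoord m k != 0] k by []; rewrite er.
Qed.

Lemma bcoord_seq m r : uniq r -> (forall k, k \notin r -> bcoord m k = 0) ->
  m = \sum_(k <- r) bcoord m k *A: e k.
Proof.
move=> ur mr; rewrite {1}(bcoord_fsum m); apply: fsum_seq => // k.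
  by move=> /bcoord_out ->; rewrite ascale0l.
by move=> /mr ->; rewrite ascale0l.
Qed.

Lemma seq_indep a r : uniq r -> (forall k, ~ D k -> a k = 0) ->
  (forall k, k \notin r -> a k = 0) -> \sum_(k <- r) a k *A: e k = 0 ->
  forall k, a k = 0.
Proof.
move=> ur aD ar; rewrite -fsum_seq //; last 2 first.
- by move=> k /aD ->; rewrite ascale0l.
- by move=> k /ar ->; rewrite ascale0l.
move=> /basis.2 h k; have [/h|/aD //] := pselect (D k); apply.
apply: sub_finite_set (finite_seq r) => l [_ /=].
by apply: contraNT => /ar ->.
Qed.

(** Uniqueness of coordinates; the rules for sums, multiples and basis vectors
    all come from it. *)
Lemma bcoord_eq m a r : uniq r -> (forall k, ~ D k -> a k = 0) ->
  (forall k, k \notin r -> a k = 0) -> m = \sum_(k <- r) a k *A: e k ->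
  forall k, bcoord m k = a k.
Proof.
move=> ur aD ar em k; have [s us ms] := bcoord_supp m.
have out l : l \notin undup (r ++ s) -> bcoord m l = 0 /\ a l = 0.
  by rewrite mem_undup mem_cat => /norP[/ar ? /ms ?].
apply/eqP; rewrite -subr_eq0; apply/eqP; move: k.
apply: (seq_indep (undup_uniq (r ++ s))).
- by move=> k nDk; rewrite bcoord_out // aD // subrr.
- by move=> k /out[-> ->]; rewrite subrr.
under eq_bigr do rewrite ascaleDl ascaleNl.
rewrite sumrB -bcoord_seq ?undup_uniq //; last by move=> k /out[].
apply/eqP; rewrite subr_eq0 {1}em; apply/eqP.
rewrite -[LHS]fsum_seq // => [|k /aD ->|k /ar ->]; rewrite ?ascale0l //.
apply: fsum_seq => [|k /aD ->|k /out[_ ->]]; rewrite ?ascale0l //.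
exact: undup_uniq.
Qed.

Lemma bcoordD m n k : bcoord (m + n) k = bcoord m k + bcoord n k.
Proof.
have [r _ mr] := bcoord_supp m; have [s _ ns] := bcoord_supp n.
have out l : l \notin undup (r ++ s) -> bcoord m l = 0 /\ bcoord n l = 0.
  by rewrite mem_undup mem_cat => /norP[/mr ? /ns ?].
move: k; apply: (bcoord_eq (undup_uniq (r ++ s))) => [k nDk|k /out[-> ->]|].
- by rewrite !bcoord_out // addr0.
- by rewrite addr0.
under eq_bigr do rewrite ascaleDl.
rewrite big_split /=; congr (_ + _); apply: bcoord_seq; rewrite ?undup_uniq //.
  by move=> k /out[].
by move=> k /out[].
Qed.

Lemma bcoordZ (a : laurent) m k : bcoord (a *A: m) k = a * bcoord m k.
Proof.
have [r ur mr] := bcoord_supp m.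
move: k; apply: (bcoord_eq ur) => [k nDk|k /mr ->|].
- by rewrite bcoord_out // mulr0.
- by rewrite mulr0.
under eq_bigr do rewrite -ascaleA.
by rewrite -raddf_sum -bcoord_seq.
Qed.

Lemma bcoord0 k : bcoord 0 k = 0.
Proof. by rewrite -(ascale0l 0) bcoordZ mul0r. Qed.

Lemma bcoordN m k : bcoord (- m) k = - bcoord m k.
Proof. by rewrite -{1}[m]ascale1 -ascaleNl bcoordZ mulN1r. Qed.

Lemma bcoord_sum (L : Type) (r : seq L) (F : L -> M) k :
  bcoord (\sum_(l <- r) F l) k = \sum_(l <- r) bcoord (F l) k.
Proof.
exact: (big_morph (bcoord^~ k) (fun m n => bcoordD m n k) (bcoord0 k)).
Qed.

Lemma bcoord_basis l k : D l -> bcoord (e l) k = (k == l)%:R.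
Proof.
move=> Dl; move: k; apply: (@bcoord_eq _ (fun k => (k == l)%:R) [:: l]) => //.
- by move=> k; case: eqP => // ->.
- by move=> k; rewrite inE => /negbTE ->.
by rewrite big_seq1 eqxx ascale1.
Qed.

Lemma bcoord_inj m n : (forall k, bcoord m k = bcoord n k) -> m = n.
Proof.
move=> emn; rewrite (bcoord_fsum m) (bcoord_fsum n).
by apply: eq_fsbigr => k _; rewrite emn.
Qed.

Lemma basis_inj k l : D k -> D l -> e k = e l -> k = l.
Proof.
move=> Dk Dl ekl; have := bcoord_basis k Dl; rewrite -ekl bcoord_basis // eqxx.
by case: eqP => // _ /eqP; rewrite oner_eq0.
Qed.

(** A semilinear map fixing the basis acts on coordinates by the bar involution,
    so bar-invariant elements have bar-invariant coordinates. *)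
Lemma bcoord_bar (bar : M -> M) :
  (forall m n, bar (m + n) = bar m + bar n) ->
  (forall (a : laurent) m, bar (a *A: m) = laurent_bar a *A: bar m) ->
  (forall k, D k -> bar (e k) = e k) ->
  forall m k, bcoord (bar m) k = laurent_bar (bcoord m k).
Proof.
move=> barD barZ bare m.
have bar0 : bar 0 = 0 by have := barZ 0 0; rewrite rmorph0 !ascale0l.
have [r ur mr] := bcoord_supp m.
apply: (@bcoord_eq _ (fun k => laurent_bar (bcoord m k)) _ ur) => [k nDk|k /mr ->|].
- by rewrite bcoord_out // rmorph0.
- by rewrite rmorph0.
rewrite {1}(bcoord_seq ur mr).
rewrite (big_morph bar barD bar0); apply: eq_bigr => k _; rewrite barZ.
have [Dk|nDk] := pselect (D k); first by rewrite bare.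
by rewrite bcoord_out // rmorph0 !ascale0l.
Qed.

End Coordinates.

Arguments bcoord_inj {H M K D e} basis {m n}.

(** * The bar-invariant generators C_s *)

Section KLGenerator.
Variables (W : groupType) (S : set W) (H : algType laurent) (T : W -> H).
Variable M : lmodType H.
Implicit Types (s : W) (m n : M).

(** The action of T_s - q, which is a Kazhdan-Lusztig basis element of the Hecke
    algebra. *)
Definition KL_gen s m : M := T s *: m - q *A: m.

Lemma KL_gen_zmod s : zmod_morphism (KL_gen s).
Proof.
move=> m n; rewrite /KL_gen scalerBr raddfB /=.
by rewrite !opprB addrACA [RHS]addrACA; congr (_ + _); exact: addrC.
Qed.

HB.instance Definition _ s :=
  GRing.isZmodMorphism.Build M M (KL_gen s) (KL_gen_zmod s).

Lemma KL_genZ s (a : laurent) m : KL_gen s (a *A: m) = a *A: KL_gen s m.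
Proof. by rewrite /KL_gen hscale_ascale raddfB /= !ascaleA mulrC. Qed.

Lemma KL_gen_act s m : T s *: m = q *A: m + KL_gen s m.
Proof. by rewrite addrC subrK. Qed.

Hypothesis hH : hecke_algebra S T.

(** T_s acts as - q^-1 on the image of T_s - q, since
    (T_s + q^-1) (T_s - q) = 0. *)
Lemma KL_gen_sq s m : S s -> KL_gen s (KL_gen s m) = - (q + qV) *A: KL_gen s m.
Proof.
move=> Ss; have -> : - (q + qV) = - qV - q by rewrite opprD addrC.
rewrite ascaleDl (ascaleNl q) {1}/KL_gen; congr (_ - _).
have Tsq : T s *: (T s *: m) = m + (q - qV) *A: (T s *: m).
  rewrite scalerA -expr2 (hH.1.1 s Ss) scalerDl scale1r /ascale scalerA.
  by rewrite -scalerAl mul1r.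
rewrite /KL_gen scalerBr Tsq hscale_ascale ascaleDl addrA addrAC addrK.
by rewrite raddfB /= ascaleA mulNr [qV * q]mulrC mulqV !ascaleNl ascale1 opprK addrC.
Qed.

Variable barH : H -> H.
Hypothesis hbarH : hecke_bar S T barH.
Variable barM : M -> M.
Hypothesis barD : forall m n, barM (m + n) = barM m + barM n.
Hypothesis barZ : forall (a : laurent) m, barM (a *A: m) = laurent_bar a *A: barM m.
Hypothesis barMH : forall h m, barM (h *: m) = barH h *: barM m.

Lemma KL_gen_bar s m : S s -> barM (KL_gen s m) = KL_gen s (barM m).
Proof.
move=> Ss; rewrite /KL_gen barD -ascaleNl barZ barMH (hbarT hbarH Ss).
rewrite rmorphN /= laurent_bar_q scalerBl -/(ascale _ _) ascaleDl !ascaleNl.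
by rewrite opprB addrA addrAC addrK.
Qed.

End KLGenerator.

(** * The action of C_s on the canonical basis *)

Section CanonicalAction.
Variables (W : groupType) (S : set W) (hS : coxeter_system S).
Variables (H : algType laurent) (T : W -> H) (hH : hecke_algebra S T).
Variables (barH : H -> H) (hbarH : hecke_bar S T barH).
Variables (J I : set W) (M : lmodType H) (b : W -> M) (barM : M -> M).
Hypothesis hI : W_graph_ideal S T barH J I b barM.
Variables (c : W -> M) (qp : W -> W -> {poly int}).
Hypothesis hc : canonical_basis S I b barM c qp.
Implicit Types s w y k : W.

Local Notation cf := (bcoord (cb_basis hc)).
Local Notation C := (KL_gen T).

Definition below y w : bool := `[< I y /\ bruhat_lt S y w >].
Definition descb s w : bool := `[< descents S J w s >].
Definition strong_asc s w : bool := `[< SA S I w s >].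

Lemma below_fin w : finite_set [set y | below y w].
Proof.
by apply: sub_finite_set (bruhat_le_fin hS w) => y /= /asboolP[_ []].
Qed.

Lemma below_seq w : exists2 r, uniq r & forall y, (y \in r) = below y w.
Proof.
have [r er] := (finite_seqP _).1 (below_fin w).
exists (undup r); first exact: undup_uniq.
move=> y; rewrite mem_undup; have /seteqP[e1 e2] := er.
by apply/idP/idP => [/e2|/e1].
Qed.

Lemma b_expansion w r : I w -> uniq r -> (forall y, (y \in r) = below y w) ->
  b w = c w + \sum_(y <- r) (q * polyq (qp y w)) *A: c y.
Proof.
move=> Iw ur er; rewrite (cb_qp hc Iw); congr (_ + _).
have -> : [set y | I y /\ bruhat_lt S y w] = [set` r].
  by apply/seteqP; split=> y /=; rewrite er => /asboolP.
rewrite -fsbig_seq // raddf_sum /=; apply: eq_bigr => y _.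
by rewrite ascaleA.
Qed.

Lemma bcoord_b w k : I w ->
  cf (b w) k = (k == w)%:R + (if below k w then q * polyq (qp k w) else 0).
Proof.
move=> Iw; have [r ur er] := below_seq w.
rewrite (b_expansion Iw ur er) bcoordD bcoord_basis // bcoord_sum; congr (_ + _).
rewrite -er -(sum_pick k (fun y => q * polyq (qp y w)) ur).
apply: eq_big_seq => y; rewrite er => /asboolP[Iy _].
by rewrite bcoordZ bcoord_basis //; case: eqP => _; rewrite ?mulr1 ?mulr0.
Qed.

Lemma bcoord_Cb s w r k : I w -> uniq r -> (forall y, (y \in r) = below y w) ->
  cf (C s (b w)) k =
    cf (C s (c w)) k + \sum_(y <- r) q * polyq (qp y w) * cf (C s (c y)) k.
Proof.
move=> Iw ur er; rewrite (b_expansion Iw ur er) raddfD raddf_sum /= bcoordD.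
by rewrite bcoord_sum; congr (_ + _); apply: eq_bigr => y _; rewrite KL_genZ bcoordZ.
Qed.

Lemma bcoord_Cc_bar s w k : S s -> I w ->
  laurent_bar (cf (C s (c w)) k) = cf (C s (c w)) k.
Proof.
move=> Ss Iw; rewrite -(bcoord_bar (cb_basis hc) (wgi_barD hI) (wgi_barZ hI)).
  rewrite (KL_gen_bar hbarH (wgi_barD hI) (wgi_barZ hI) (wgi_barH hI)) //.
  by rewrite (cb_bar hc).
exact: cb_bar hc.
Qed.

Lemma laurent_bar_qqV : laurent_bar (q + qV) = q + qV.
Proof.
have barqV : laurent_bar qV = q.
  have : laurent_bar q * laurent_bar qV = 1 by rewrite -rmorphM mulqV rmorph1.
  rewrite laurent_bar_q => /(congr1 (fun x => q * x)).
  by rewrite mulrA mulqV mul1r mulr1.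
by rewrite rmorphD /= laurent_bar_q barqV addrC.
Qed.

Lemma desc_cases s w : S s -> I w ->
  [\/ strong_asc s w /\ ~~ descb s w, WA S J I w s /\ ~~ descb s w,
      descb s w /\ SD S w s | descb s w /\ WD S J w s].
Proof.
move=> Ss Iw; have [sw|sw] := gen_bruhat_total hS w Ss.
  by constructor 3; split=> //; apply/asboolP; left.
have nSD : ~ SD S w s.
  move=> [_ /(bruhat_lt_len hS)/(ltn_trans (bruhat_lt_len hS sw))].
  by rewrite ltnn.
have [D|nD] := pselect (DJ S J (s * w)%g); last first.
  by constructor 4; split; [apply/asboolP; right|].
have nd : ~~ descb s w by apply/asboolPn => -[//|[]].
have [Isw|nI] := pselect (I (s * w)%g).
  by constructor 1; split=> //; apply/asboolP.
by constructor 2.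
Qed.

(** The induction statement at w.  The constant terms of the q_{y,w} with s a
    descent of w and not of y are the coefficients which, in the W-graph relation
    at y, belong to elements w larger than y. *)
Definition canonical_action w : Prop := forall s, S s ->
  (descb s w -> C s (c w) = - (q + qV) *A: c w /\
    forall y, below y w -> ~~ descb s y -> (qp y w)`_0 = (y == s * w)%g%:R) /\
  (~~ descb s w -> forall k, cf (C s (c w)) k =
    ((strong_asc s w && (k == s * w)%g)%:R +
     (if below k w && descb s k then (qp k w)`_0 else 0))%:~R).

Lemma strong_asc_desc s w : S s -> strong_asc s w -> descb s (s * w)%g.
Proof.
move=> Ss /asboolP[_ lt _]; apply/asboolP; left; split=> //.
by rewrite (gen_mulK hS).
Qed.

(** If C_s c_y involves c_{sy}, then s is a descent of sy; hence the image of C_s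
    lies in the span of the c_k having s as a descent. *)
Lemma bcoord_Cc_nondesc s y k : S s -> I y -> canonical_action y ->
  ~~ descb s k -> cf (C s (c y)) k = 0.
Proof.
move=> Ss Iy /(_ s Ss)[ay ny] nk.
have [dy|/ny ->] := boolP (descb s y).
  rewrite (ay dy).1 bcoordZ bcoord_basis //.
  by case: eqP => [ky|]; [rewrite ky dy in nk | rewrite mulr0].
rewrite (negbTE nk) andbF addr0.
case: (boolP (strong_asc s y)) => //= sy; case: eqP => // ky.
by rewrite ky strong_asc_desc in nk.
Qed.

(** Only the eigenvectors of C_s contribute to the constant term: the factor q
    kills the integral coordinates, whereas - q (q + q^-1) has constant term
    -1. *)
Lemma const_term_Cc s y k p : S s -> I y -> canonical_action y ->
  const_term (q * polyq p * cf (C s (c y)) k)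
    (if k == y then if descb s y then - p`_0 else 0 else 0).
Proof.
move=> Ss Iy /(_ s Ss)[ay ny].
have [dy|/ny ->] := boolP (descb s y); last first.
  rewrite if_same -mulrA; apply: const_term_qM.
  exact: const_termM (const_term_polyq p) (const_term_int _).
rewrite (ay dy).1 bcoordZ bcoord_basis //.
have [_|_] := eqVneq k y; last by rewrite mulr0 mulr0; exact: (const_term_int 0).
have -> : q * polyq p * (- (q + qV) * 1) = - ((q * q + 1) * polyq p).
  by rewrite mulr1 -mulqV; ring.
apply: const_termN; rewrite -[p`_0]mul1r.
apply: const_termM; last exact: const_term_polyq.
rewrite -[X in const_term _ X]add0r.
exact: const_termD (const_term_qM const_term_q) (const_term_int 1).
Qed.

Lemma const_term_b w k : I w -> const_term (cf (b w) k) (k == w)%:R.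
Proof.
move=> Iw; rewrite bcoord_b // -[X in const_term _ X]addr0; apply: const_termD.
  by case: (k == w); [exact: (const_term_int 1)|exact: (const_term_int 0)].
case: ifP => _; last exact: (const_term_int 0).
exact: const_term_qM (const_term_polyq _).
Qed.

Lemma const_term_Cb s w k : S s -> I w -> ~~ descb s w ->
  const_term (cf (C s (b w)) k) (strong_asc s w && (k == s * w)%g)%:R.
Proof.
move=> Ss Iw nd.
have [[sa _]|[wa _]|[d]|[d]] := desc_cases Ss Iw; try by rewrite d in nd.
  have SAw : SA S I w s by exact/asboolP.
  rewrite sa /= /KL_gen (wgi_SA hI Iw SAw) bcoordD bcoordN bcoordZ.
  have [_ _ Isw] := SAw.
  rewrite -[X in const_term _ X]subr0; apply: const_termD.
    exact: const_term_b.
  exact: const_termN (const_term_qM (const_term_b k Iw)).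
have [_ _ [_ nI]] := wa.
have /negbTE -> /= : ~~ strong_asc s w by apply/asboolPn => -[].
have [rp er] := wgi_WA hI Iw wa.
rewrite /KL_gen er addrAC subrr add0r.
have [r ur mr] := below_seq (s * w)%g.
have -> : [set y | I y /\ bruhat_lt S y (s * w)%g] = [set` r].
  by apply/seteqP; split=> y /=; rewrite mr => /asboolP.
rewrite -fsbig_seq // bcoordN bcoord_sum -[X in const_term _ X]oppr0.
apply: const_termN.
have -> : 0 = \sum_(y <- r) (0 : int) by rewrite big1.
apply: const_term_sum => y; rewrite mr => /asboolP[Iy _].
rewrite bcoordZ rmorphM /= polyqX -mulrA; apply: const_term_qM.
exact: const_termM (const_term_polyq _) (const_term_b k Iy).
Qed.

(** By [const_term_Cb] and [const_term_Cc] the coordinates of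
    C_s c_w = C_s b_w - sum of q q_{y,w} C_s c_y have the constant terms on the
    right-hand side, and they are bar-invariant. *)
Lemma canonical_action_nondesc s w k : S s -> I w ->
  (forall y, below y w -> canonical_action y) -> ~~ descb s w ->
  cf (C s (c w)) k = ((strong_asc s w && (k == s * w)%g)%:R +
     (if below k w && descb s k then (qp k w)`_0 else 0))%:~R.
Proof.
move=> Ss Iw IH nd; have [r ur mr] := below_seq w.
apply: const_term_bar; last exact: bcoord_Cc_bar.
have -> : cf (C s (c w)) k = cf (C s (b w)) k -
    \sum_(y <- r) q * polyq (qp y w) * cf (C s (c y)) k.
  by rewrite (bcoord_Cb s k Iw ur mr) addrK.
apply: const_termD; first exact: const_term_Cb.
have -> : (if below k w && descb s k then (qp k w)`_0 else 0) =
    - \sum_(y <- r) (if k == y then if descb s y then - (qp y w)`_0 else 0 else 0).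
  rewrite sum_pick // mr; case: (below k w); last by rewrite oppr0.
  by case: (descb s k); rewrite ?opprK ?oppr0.
apply: const_termN; apply: const_term_sum => y; rewrite mr => lyw.
by apply: const_term_Cc => //; [have /asboolP[] := lyw | exact: IH].
Qed.

(** As C_s b_w = - (q + q^-1) b_w, the vector (C_s + q + q^-1) c_w, whose
    coordinates are called x below, is minus the sum of the
    q q_{y,w} (C_s + q + q^-1) c_y. *)
Lemma canonical_action_WD s w : S s -> I w ->
  (forall y, below y w -> canonical_action y) -> WD S J w s ->
  C s (c w) = - (q + qV) *A: c w /\
    forall y, below y w -> ~~ descb s y -> qp y w = 0.
Proof.
move=> Ss Iw IH wd; have [r ur mr] := below_seq w.
have dw : descb s w by apply/asboolP; right.
pose x k := cf (C s (c w)) k + (q + qV) * (k == w)%:R.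
have xbar k : laurent_bar (x k) = x k.
  by rewrite rmorphD rmorphM /= laurent_bar_qqV bcoord_Cc_bar // rmorph_nat.
have xE k : x k = - \sum_(y <- r) q * polyq (qp y w) *
    (cf (C s (c y)) k + (q + qV) * (k == y)%:R).
  have := bcoord_Cb s k Iw ur mr.
  have -> : C s (b w) = - (q + qV) *A: b w.
    by rewrite /KL_gen (wgi_WD hI Iw wd) -ascaleNl -ascaleDl opprD addrC.
  rewrite bcoordZ bcoord_b //.
  have -> : (if below k w then q * polyq (qp k w) else 0) =
     \sum_(y <- r) q * polyq (qp y w) * (k == y)%:R.
    rewrite -mr -(sum_pick k (fun y => q * polyq (qp y w)) ur).
    by apply: eq_bigr => y _; case: eqP; rewrite ?mulr1 ?mulr0.
  set z := (X in _ = _ + X -> _) => e; rewrite /x -[cf _ _](addrK z) -e /z.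
  under [in RHS]eq_bigr do rewrite mulrDr mulrCA.
  rewrite big_split -mulr_sumr /=; ring.
(* If s is a descent of k, the term of y = k vanishes by induction and the other
   terms have constant term 0. *)
have x0 k : descb s k -> x k = 0.
  move=> dk; apply: (@const_term_bar _ 0) => //; rewrite xE.
  have -> : 0 = - \sum_(y <- r) (0 : int) by rewrite big1 ?oppr0.
  apply: const_termN; apply: const_term_sum => y; rewrite mr => lyw.
  have [Iy _] := asboolW lyw.
  have [dy|ndy] := boolP (descb s y).
    have [-> _] := (IH _ lyw s Ss).1 dy.
    by rewrite bcoordZ bcoord_basis // mulNr addNr mulr0; exact: (const_term_int 0).
  have := @const_term_Cc s y k (qp y w) Ss Iy (IH _ lyw).
  rewrite (negbTE ndy) if_same; have -> : k == y = false.
    by apply/eqP => ky; rewrite ky (negbTE ndy) in dk.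
  by rewrite mulr0 addr0.
(* If s is not a descent of y, only the term of y itself contributes to x y. *)
have qp0 y : below y w -> ~~ descb s y -> x y = 0 /\ qp y w = 0.
  move=> lyw ndy.
  have xy : x y = polyq (- (('X ^+ 2 + 1) * qp y w)).
    rewrite xE rmorphN rmorphM rmorphD rmorphXn /= polyqX rmorph1; congr (- _).
    rewrite (eq_big_seq (fun z =>
        if y == z then (q ^+ 2 + 1) * polyq (qp z w) else 0)).
      by rewrite sum_pick // mr lyw.
    move=> z; rewrite mr => lzw; have [Iz _] := asboolW lzw.
    rewrite (@bcoord_Cc_nondesc s z y) //; last exact: IH.
    case: eqP => _; last by rewrite mulr0 addr0 mulr0.
    by rewrite mulr1 -mulqV; ring.
  have := xbar y; rewrite xy => /polyq_bar_const e.
  suff qz : qp y w = 0 by split=> //; rewrite qz mulr0 oppr0 rmorph0.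
  (* 1 + X^2 times a nonzero polynomial is not constant. *)
  apply: contraTeq isT => nz; move/(congr1 (fun p : {poly int} => size p)): e.
  rewrite size_polyN size_polyC size_proper_mul; last first.
    rewrite mulf_neq0 // lead_coef_eq0 //.
    by rewrite -size_poly_eq0 size_XnaddC.
  rewrite size_XnaddC //= ; move: nz; rewrite -size_poly_eq0.
  by case: (size _) => // n _; case: (_ != 0).
split; last by move=> y lyw ndy; have [] := qp0 y lyw ndy.
apply: (bcoord_inj (cb_basis hc)) => k; rewrite bcoordZ bcoord_basis //.
apply/eqP; rewrite mulNr -addr_eq0 -/(x k); apply/eqP.
have [/x0 //|ndk] := boolP (descb s k).
have [/qp0 [] //|nlk] := boolP (below k w).
rewrite xE big_seq big1 ?oppr0 // => y; rewrite mr => lyw.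
have [Iy _] := asboolW lyw.
rewrite (@bcoord_Cc_nondesc s y k) //; last exact: IH.
case: eqP => [ky|]; last by rewrite mulr0 addr0 mulr0.
by rewrite ky lyw in nlk.
Qed.

(** For the second part: at y with s not a descent of y, all the coordinates of
    the C_s c_z with z < w vanish, and so does that of C_s c_w.  Comparing with
    C_s b_w = b_{sw} - q^-1 b_w shows that q_{y,w} is the coordinate of b_{sw}
    at y, whose constant term is 1 if y = sw and 0 otherwise. *)
Lemma canonical_action_SD s w : S s -> I w ->
  (forall y, below y w -> canonical_action y) -> SD S w s ->
  C s (c w) = - (q + qV) *A: c w /\
    forall y, below y w -> ~~ descb s y -> (qp y w)`_0 = (y == s * w)%g%:R.
Proof.
move=> Ss Iw IH sd; set v := (s * w)%g.
have Iv : I v by exact: (wgi_ideal hI Iw (SD_weak_le hS sd)).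
have lvw : below v w by apply/asboolP; split=> //; exact: sd.2.
have svw : (s * v)%g = w by exact: (gen_mulK hS).
have sav : strong_asc s v.
  by apply/asboolP; split=> //; rewrite ?svw //; exact: sd.2.
have ndv : ~~ descb s v.
  have [[]//|[]//|[_ [_]]|[_ [_ _]]] := desc_cases Ss Iv.
    rewrite svw => /(bruhat_lt_len hS)/ltn_trans/(_ (bruhat_lt_len hS sd.2)).
    by rewrite ltnn.
  by rewrite svw => /(_ (wgi_DJ hI Iw)).
have [r ur mr] := below_seq v.
(* This determines c_w as a combination of eigenvectors of C_s. *)
have Cv : C s (c v) = c w +
    \sum_(y <- r) (if descb s y then ((qp y v)`_0)%:~R else 0) *A: c y.
  apply: (bcoord_inj (cb_basis hc)) => k.
  rewrite ((IH v lvw s Ss).2 ndv) sav svw /= bcoordD bcoord_basis // bcoord_sum.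
  rewrite rmorphD; congr (_ + _); first by case: eqP.
  rewrite (eq_big_seq (fun y =>
      if k == y then if descb s y then ((qp y v)`_0)%:~R else 0 else 0)).
    by rewrite sum_pick // mr; case: (below k v); case: (descb s k).
  move=> y; rewrite mr => /asboolP[Iy _]; rewrite bcoordZ bcoord_basis //.
  by case: eqP; rewrite ?mulr1 ?mulr0.
have Cw : C s (c w) = - (q + qV) *A: c w.
  have := KL_gen_sq hH (c v) Ss; rewrite {1}Cv raddfD raddf_sum /=.
  rewrite (eq_big_seq (fun y => - (q + qV) *A:
      ((if descb s y then ((qp y v)`_0)%:~R else 0) *A: c y))).
    by rewrite -raddf_sum Cv (raddfD (ascale _)) /= => /addIr.
  move=> y; rewrite mr => /asboolP[Iy yv]; rewrite KL_genZ.
  case: ifP => dy; last by rewrite !ascale0l raddf0.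
  have lyw : below y w.
    by apply/asboolP; split=> //; exact: (bruhat_lt_trans hS yv sd.2).
  by rewrite ((IH y lyw s Ss).1 dy).1 !ascaleA mulrC.
split=> // y lyw ndy; have [r' ur' mr'] := below_seq w.
have [Iy ylt] := asboolW lyw.
have yw : y == w = false by apply/eqP; exact: ylt.2.
have := bcoord_Cb s y Iw ur' mr'.
have -> : C s (b w) = b v - qV *A: b w.
  rewrite /KL_gen (wgi_SD hI Iw sd) -addrA -ascaleNl -ascaleDl addrAC subrr add0r.
  by rewrite ascaleNl.
rewrite Cw bcoordZ bcoord_basis // yw mulr0 add0r big_seq big1 => [|z]; last first.
  rewrite mr' => lzw; have [Iz _] := asboolW lzw.
  by rewrite (@bcoord_Cc_nondesc s z y) ?mulr0 //; exact: IH.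
rewrite bcoordD bcoordN bcoordZ [cf (b w) y]bcoord_b // yw lyw add0r.
rewrite mulrA [qV * q]mulrC mulqV mul1r => /eqP; rewrite subr_eq0 => /eqP e.
have [p ep <-] := const_term_b y Iv.
by have -> : qp y w = p by apply: polyq_inj; rewrite -e.
Qed.

Lemma canonical_actionP w : I w -> canonical_action w.
Proof.
elim: {w}(len S w).+1 {-2}w (ltnSn (len S w)) => // n IHn w lenw Iw.
have IH y : below y w -> canonical_action y.
  move=> /asboolP[Iy /(bruhat_lt_len hS) lt]; apply: IHn => //.
  exact: leq_trans lt lenw.
move=> s Ss; split=> [d|nd k]; last exact: canonical_action_nondesc.
have [[_]|[_]|[_ sd]|[_ wd]] := desc_cases Ss Iw; try by rewrite d.
  exact: canonical_action_SD.
have [eC qp0] := canonical_action_WD Ss Iw IH wd; split=> // y lyw ndy.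
rewrite qp0 // coef0; case: eqP => // ey.
have [_ _ []] := wd; rewrite -ey; apply: (wgi_DJ hI).
by have [] := asboolW lyw.
Qed.

End CanonicalAction.

(** * The W-graph *)

Lemma A_basis_reindex (H : algType laurent) (M : lmodType H) (K L : choiceType)
    (D : set K) (e : K -> M) (h : L -> K) :
  set_bij setT D h -> A_basis D e -> A_basis setT (e \o h).
Proof.
move=> hbij [gen ind]; have [hD hinj hsurj] := hbij.
have fsumh (a : K -> laurent) :
    \sum_(k \in D) a k *A: e k = \sum_(l \in setT) a (h l) *A: (e \o h) l.
  exact: (reindex_fsbig h setT D (fun k => a k *A: e k) hbij).
split=> [m|a].
  have [a fin ->] := gen m; exists (a \o h); last exact: fsumh.
  apply: (@sub_finite_set _ _ (h @^-1` (D `&` [set k | a k != 0]))).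
    by move=> l [_ al]; split=> //; exact: hD.
  by apply: finite_preimage => // l l' _ _; apply: hinj; rewrite inE.
have [g gK] : exists g : K -> option L, forall l, g (h l) = Some l.
  exists (fun k => if pselect (exists l, h l = k) is left ex
                   then Some (projT1 (cid ex)) else None) => l.
  case: pselect => [ex|[]]; last by exists l.
  by case: cid => l' /= /hinj ->; rewrite ?inE.
pose a' k := if g k is Some l then a l else 0.
have a'h l : a' (h l) = a l by rewrite /a' gK.
move=> fin a0 l _; rewrite -a'h; apply: ind; last exact: hD.
  apply: sub_finite_set (finite_image h fin) => k [Dk /= nz].
  have [l' _ hl'] := hsurj k Dk; exists l'; last exact: hl'.
  by split; [exact: I|rewrite /= -a'h hl'; exact: nz].
rewrite fsumh -[RHS]a0; apply: eq_fsbigr => l' _.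
by rewrite a'h.
Qed.

Section CanonicalSet.
Variables (W : groupType) (M : choiceType) (I : set W) (c : W -> M).

Lemma canonical_label_exists (v : c @` I) :
  exists w, exists Iw : I w, v = in_img c Iw.
Proof.
have [w Iw ew] := set_mem (valP v); exists w, Iw.
by apply: val_inj.
Qed.

(** The index w in I of an element c_w of the set C. *)
Definition label (v : c @` I) : W := projT1 (cid (canonical_label_exists v)).

Lemma labelP v : I (label v).
Proof. by rewrite /label; case: cid => w [/= Iw _]. Qed.

Lemma labelK v : in_img c (labelP v) = v.
Proof.
apply: val_inj => /=; rewrite /label; case: cid => w [/= Iw ->].
by [].
Qed.

Lemma label_bij : {in I &, injective c} -> set_bij setT I label.
Proof.
move=> cinj; split=> [v _|v v' _ _ e|w Iw]; first exact: labelP.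
  by apply: val_inj; rewrite -(labelK v) -(labelK v') /= e.
exists (in_img c Iw) => //; apply: cinj; rewrite ?inE //; first exact: labelP.
by have := congr1 val (labelK (in_img c Iw)).
Qed.

End CanonicalSet.

Unset Implicit Arguments.

Theorem theorem7p6
  (W : groupType) (S : set W) (hS : coxeter_system S)
  (H : algType laurent) (T : W -> H) (hH : hecke_algebra S T)
  (barH : H -> H) (hbarH : hecke_bar S T barH)
  (J I : set W) (M : lmodType H) (b : W -> M) (barM : M -> M)
  (hI : W_graph_ideal S T barH J I b barM)
  (c : W -> M) (qp : W -> W -> {poly int})
  (hc : canonical_basis S I b barM c qp)
  (mu : c @` I -> c @` I -> int) (tau : c @` I -> set W)
  (hmu : forall (y w : W) (hy : I y) (hw : I w),
     mu (in_img c hy) (in_img c hw) =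
       if `[< bruhat_lt S y w >] then (qp y w)`_0
       else if `[< bruhat_lt S w y >] then (qp w y)`_0
       else 0)
  (htau : forall (w : W) (hw : I w), tau (in_img c hw) = descents S J w) :
  W_graph S T mu tau.
Proof.
have cinj : {in I &, injective c}.
  by move=> k l /set_mem Ik /set_mem Il; exact: (basis_inj (cb_basis hc)).
have lbij := label_bij cinj.
have tauE v : tau v = descents S J (label v) by rewrite -{1}(labelK v) htau.
have descE v s : tau v s <-> descb S J s (label v).
  by rewrite tauE; split=> [?|/asboolP //]; apply/asboolP.
split.
  by move=> v s; rewrite tauE => -[[Ss _]|[Ss _ _]].
exists M, (c \o @label W M I c); split.
  exact: A_basis_reindex lbij (cb_basis hc).
move=> s v Ss /=; set w := label v.
have Iw : I w by exact: labelP.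
have act y : I y -> canonical_action T J hc y.
  exact: (canonical_actionP hS hH hbarH hI hc).
rewrite KL_gen_act; split=> [/descE d|nd].
  by rewrite ((act w Iw s Ss).1 d).1 -ascaleDl opprD addrA subrr add0r.
have {}nd : ~~ descb S J s w by apply/negP => /descE.
(* For u = c_y with y > w, the induction statement at y gives mu = 1 if y = sw
   and 0 otherwise; this is the first summand. *)
have muE u : tau u s -> mu u v =
    (strong_asc S I s w && (label u == s * w)%g)%:R +
     (if below S I (label u) w && descb S J s (label u)
      then (qp (label u) w)`_0 else 0).
  move=> /descE du; rewrite -{1}(labelK u) -{1}(labelK v) hmu du andbT -/w.
  set y := label u in du *; have Iy : I y by exact: labelP.
  case: asboolP => [yw|nyw].
    rewrite /below asboolT //; case: eqP => [ey|_]; last by rewrite andbF add0r.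
    case: (boolP (strong_asc _ _ _ _)); rewrite ?add0r // => /asboolP[_ ws _].
    have := bruhat_lt_len hS yw; rewrite ey => lt.
    by have := ltn_trans lt (bruhat_lt_len hS ws); rewrite ltnn.
  have -> : below S I y w = false by apply/asboolPn => -[].
  rewrite addr0; case: asboolP => [wy|nwy].
    rewrite ((act y Iy s Ss).1 du).2 //; last by apply/asboolP.
    have -> : (w == s * y)%g = (y == s * w)%g.
      by apply/eqP/eqP => ->; rewrite (gen_mulK hS).
    case: eqP => [ey|_]; last by rewrite andbF.
    by rewrite /strong_asc asboolT // /SA /= -ey.
  case: (boolP (strong_asc _ _ _ _)) => //= /asboolP[_ ws _].
  by case: eqP => // ey; rewrite -ey in ws.
pose g y : int := (strong_asc S I s w && (y == s * w)%g)%:R +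
     (if below S I y w && descb S J s y then (qp y w)`_0 else 0).
split.
  apply: (@sub_finite_set _ _ (@label _ _ I c @^-1`
     ([set (s * w)%g] `|` [set y | below S I y w]))).
    move=> u [tu]; rewrite /= muE //.
    have [->|_] := eqVneq (label u) (s * w)%g; first by left.
    by rewrite andbF add0r; case: (below S I _ _) => //= _; right.
  apply: finite_preimage; last first.
    by rewrite finite_setU; split; [exact: finite_set1|exact: below_fin].
  by move=> u u' _ _; case: lbij => _ linj _; apply: linj; rewrite inE.
congr (_ + _).
rewrite [LHS](bcoord_fsum (cb_basis hc)) (reindex_fsbig _ _ _ _ lbij) /=.
under eq_fsbigr => u _ do rewrite ((act w Iw s Ss).2 nd) ascale_int -/(g _).
rewrite -(fsbig_widen [set u | tau u s] setT) //=.
  by apply: eq_fsbigr => u; rewrite inE => tu; rewrite /= muE.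
move=> u [_ /= ntu]; rewrite /g.
have /negbTE ndu : ~~ descb S J s (label u) by apply/negP => /descE.
rewrite ndu andbF addr0; case: (boolP (strong_asc _ _ _ _)) => //= sa.
case: eqP => // eu; move: ndu; rewrite eu.
by rewrite (strong_asc_desc hS J Ss sa).
Qed.
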